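(* Let $M : \mathbb{Z}[X] \to \{\mathrm{tt},\mathrm{ff}\}$ be an arbitrary (total) Boolean-valued function, regarded as a subset $M\subseteq\mathbb{Z}[X]$ with decidable membership, and let $\nu : \mathbb{Z}[X]\to\mathbb{Z}[X]$ be an arbitrary map. Then either there exists a prime number $p$ with $p\in M$, or there is evidence that $(M,\nu)$ is not an explicit maximal ideal in $\mathbb{Z}[X]$.
   Context: All rings are commutative (with $1$). A decidable subset of a ring $R$ is given by a total function $M:R\to\{\mathrm{tt},\mathrm{ff}\}$; write $x\in M$ for $M(x)=\mathrm{tt}$ and $x\notin M$ for $M(x)=\mathrm{ff}$. A prime number $p$ is regarded as a constant polynomial in $\mathbb{Z}[X]$. For $M:R\to\{\mathrm{tt},\mathrm{ff}\}$ and a function $\nu:R\to R$, the pair $(M,\nu)$ is an explicit maximal ideal if $M$ is an ideal of $R$ (i.e. $0\in M$; $x+y\in M$ for all $x,y\in M$; $\lambda x\in M$ for all $\lambda\in R$, $x\in M$), $1\notin M$, and $a\,\nu(a)-1\in M$ for all $a\in R\setminus M$. There is evidence that $(M,\nu)$ is not an explicit maximal ideal if one of the following cases holds: (1) $0\notin M$; (2) there are $a,b\in M$ with $a+b\notin M$; (3) there are $\lambda\in R$ and $a\in M$ with $\lambda a\notin M$; (4) $1\in M$; (5) there is $a\in R\setminus M$ with $a\,\nu(a)-1\notin M$. The ''either ... or'' is a (non-exclusive) disjunction, understood constructively: it is to be decided which alternative holds; in the first, the prime $p$ is given explicitly; in the second, it is specified which of the cases (1)--(5) holds, together with the explicit elements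 $a,b,\lambda$ in cases (2), (3), (5). *)

(* Defs.v *)
From HB Require Import structures.
From mathcomp Require Import all_boot all_order all_algebra.

Set Implicit Arguments.
Unset Strict Implicit.
Unset Printing Implicit Defensive.

Import GRing.Theory.
Local Open Scope ring_scope.

(* A decidable subset of R is a Boolean-valued function M, and
   "x belongs to M" is M x.  R may be the zero ring, hence comPzRingType. *)

Record explicit_maximal_ideal (R : comPzRingType) (M : R -> bool) (nu : R -> R)
    : Prop := ExplicitMaximalIdeal {
  emi_zero : M 0;
  emi_add : forall x y : R, M x -> M y -> M (x + y);
  emi_mul : forall lambda x : R, M x -> M (lambda * x);
  emi_one : ~~ M 1;
  emi_inv : forall a : R, ~~ M a -> M (a * nu a - 1)
}.

(* Evidence lives in Type, not Prop: an inhabitant is a witness that records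
   which axiom fails and the explicit elements at which it fails. *)
Inductive not_emi_evidence (R : comPzRingType) (M : R -> bool) (nu : R -> R)
    : Type :=
| EvZero of ~~ M 0
| EvAdd (a b : R) of M a & M b & ~~ M (a + b)
| EvMul (lambda a : R) of M a & ~~ M (lambda * a)
| EvOne of M 1
| EvInv (a : R) of ~~ M a & ~~ M (a * nu a - 1).

Lemma not_emi_evidenceP (R : comPzRingType) (M : R -> bool) (nu : R -> R) :
  not_emi_evidence M nu -> ~ explicit_maximal_ideal M nu.
Proof.
move=> ev [M0 MD MM M1 MV]; case: ev => [/negP | a b Ma Mb /negP | l a Ma /negP
  | M1' | a Na /negP]; first by apply.
- by apply; apply: MD.
- by apply; apply: MM.
- by rewrite M1' in M1.
- by apply; apply: MV.
Qed.

(* Main.v *)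
Require Import Defs.
From mathcomp Require Import all_boot all_order all_algebra ring.

Set Implicit Arguments.
Unset Strict Implicit.
Unset Printing Implicit Defensive.

Import GRing.Theory.
Local Open Scope ring_scope.

(** If (M, nu) really were an explicit maximal ideal, Z[X]/M would be a field
    that is finitely generated as a ring, and such a field has positive
    characteristic.  The proof makes this fact effective: it needs only finitely
    many instances of the axioms, so each of them can be tested when it is used,
    and a failed test is the required evidence.

    First, M contains a nonzero polynomial f, namely 'X or 'X * nu 'X - 1.
    Choose a prime p that does not divide the leading coefficient c of f.
    If p is not in M, then nu provides g := p * nu p - 1 in M.  In the field
    Z[X]/M, which is integral over Z[1/c] because of f, an inverse of p would be
    integral over Z[1/c], where p is not invertible.  Concretely, f and g are
    coprime over Q ([coprimep_of_reduction]), so that a Bezout combination of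
    them is a nonzero integer N, which lies in M.  Finally, if M contained no
    prime factor of N, then nu would invert these factors one after the other
    modulo M, until 1 is in M ([prime_of_nat_mem]). *)

(** Evidence lives in [Type], and so do the disjunctions here: each failure of
    the conclusion [M _] points to the instance of an axiom that caused it. *)
Lemma mem_combination (R : comPzRingType) (M : R -> bool) (nu : R -> R)
    (u a v b : R) :
  M a -> M b -> (M (u * a + v * b)%R + not_emi_evidence M nu)%type.
Proof.
move=> Ma Mb.
case Mua: (M (u * a)); last by right; apply: (EvMul nu Ma (negbT Mua)).
case Mvb: (M (v * b)); last by right; apply: (EvMul nu Mb (negbT Mvb)).
case Mab: (M (u * a + v * b)); first by left.
by right; apply: (EvAdd nu Mua Mvb (negbT Mab)).
Qed.

(** The prime factors of n are stripped off one at a time: when p is outside M,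
    the identity m = nu p * (p * m) - m * (p * nu p - 1) puts m = n / p in M. *)
Lemma prime_of_nat_mem (R : comPzRingType) (M : R -> bool) (nu : R -> R)
    (n : nat) :
  (0 < n)%N -> M n%:R ->
  ({p : nat | prime p & M p%:R} + not_emi_evidence M nu)%type.
Proof.
elim/ltn_ind: n => n IHn n_gt0 Mn.
have [n_le1 | n_gt1] := leqP n 1.
  have n1 : n = 1 by apply/eqP; rewrite eqn_leq n_le1.
  by right; apply: EvOne; rewrite n1 in Mn.
pose p := pdiv n; have p_pr : prime p by apply: pdiv_prime.
case Mp: (M p%:R); first by left; exists p.
case Mpg: (M (p%:R * nu p%:R - 1)); last first.
  by right; apply: (EvInv (negbT Mp) (negbT Mpg)).
have n_eq : n = (p * (n %/ p))%N by rewrite mulnC divnK ?pdiv_dvd.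
case: (mem_combination nu (nu p%:R) (- (n %/ p)%:R) Mn Mpg) => [|ev];
  last by right.
suff ->: nu p%:R * n%:R + - (n %/ p)%:R * (p%:R * nu p%:R - 1)
          = (n %/ p)%:R.
  apply: IHn; first by rewrite ltn_Pdiv ?prime_gt1.
  by rewrite divn_gt0 ?prime_gt0 // dvdn_leq ?pdiv_dvd.
by rewrite {1}n_eq natrM; ring.
Qed.

(** A common divisor may be taken primitive, so that by Gauss it divides f and g
    in Z[X].  Its leading coefficient divides that of f, hence reduction to F
    keeps its degree; but its reduction divides a nonzero constant. *)
Lemma coprimep_of_reduction (F : fieldType) (f g : {poly int}) :
  (lead_coef f)%:~R != 0 :> F ->
  size (map_poly intr g : {poly F}) = 1 ->
  coprimep f g.
Proof.
move=> cF_neq0 size_gF; rewrite /coprimep -size_zprimitive.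
have [r f_eq] := dvdpP_int (dvdp_gcdl f g).
have [s g_eq] := dvdpP_int (dvdp_gcdr f g).
set h := zprimitive _ in f_eq g_eq *.
have hF_neq0 : (lead_coef h)%:~R != 0 :> F.
  by move: cF_neq0; rewrite f_eq lead_coefM rmorphM mulf_eq0 => /norP[].
rewrite -(size_map_poly_id0 hF_neq0) -dvdp1.
have /eqp_dvdr <- : map_poly intr g %= (1 : {poly F}).
  by rewrite -size_poly_eq1 size_gF.
by rewrite g_eq rmorphM dvdp_mulr.
Qed.

Lemma coprimep_int_combination (f g : {poly int}) :
  coprimep f g ->
  {N : int & {uv : {poly int} * {poly int} |
    N != 0 & uv.1 * f + uv.2 * g = N%:P}}.
Proof.
rewrite /coprimep (eqp_size (egcdpE f g)) => /size_poly1P/sig2_eqW[N N_neq0 e].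
by exists N, (egcdp f g).
Qed.

Lemma nonzero_mem (M : {poly int} -> bool) (nu : {poly int} -> {poly int}) :
  ({f : {poly int} | f != 0%R & M f} + not_emi_evidence M nu)%type.
Proof.
case MX: (M 'X); first by left; exists 'X; rewrite ?polyX_eq0.
case MXg: (M ('X * nu 'X - 1)); last first.
  by right; apply: (EvInv (negbT MX) (negbT MXg)).
left; exists ('X * nu 'X - 1) => //.
(* This polynomial takes the value -1 at 0. *)
by apply/eqP => /(congr1 (horner^~ 0)); rewrite !hornerE.
Qed.

Theorem theorem2 (M : {poly int} -> bool) (nu : {poly int} -> {poly int}) :
  ({p : nat | prime p & M (p%:Z)%:P} + not_emi_evidence M nu)%type.
Proof.
have polyC_nat (n : nat) : (n%:Z)%:P = n%:R :> {poly int}.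
  by rewrite -polyC_natr natz.
case: (nonzero_mem M nu) => [[f f_neq0 Mf] | ev]; last by right.
pose c := lead_coef f; have c_neq0 : c != 0 by rewrite lead_coef_eq0.
(* A prime factor of |c| + 1 cannot divide c. *)
pose p := pdiv (`|c|%N).+1.
have p_pr : prime p by rewrite pdiv_prime // ltnS absz_gt0.
have p_ndvd_c : ~~ (p %| `|c|)%N.
  apply/negP => p_dvd_c; have := pdiv_dvd (`|c|%N).+1.
  by rewrite -/p -addn1 dvdn_addr // dvdn1 => /eqP p1; rewrite p1 in p_pr.
case Mp: (M (p%:Z)%:P); first by left; exists p.
set g := (p%:Z)%:P * nu (p%:Z)%:P - 1.
case Mg: (M g); last by right; apply: (EvInv (negbT Mp) (negbT Mg)).
have cop_fg : coprimep f g.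
  apply: (@coprimep_of_reduction 'F_p).
    by rewrite -(dvdz_pcharf (pchar_Fp p_pr)).
  (* Modulo p, the polynomial g is the constant -1. *)
  rewrite /g rmorphB rmorphM /= map_polyC /= rmorph1 -pmulrn.
  by rewrite (pcharf0 (pchar_Fp p_pr)) mul0r sub0r size_polyN size_poly1.
have [N [[u v] N_neq0 /= uv_eq]] := coprimep_int_combination cop_fg.
case: (mem_combination nu u v Mf Mg) => [MN | ev]; last by right.
rewrite uv_eq in MN.
case: (mem_combination nu (Num.sg N)%:P 0 MN MN) => [MabsN | ev]; last by right.
rewrite mul0r addr0 -polyCM -Num.Theory.normrEsg in MabsN.
case: (@prime_of_nat_mem _ M nu `|N|%N) => [||[q q_pr Mq] | ev].
- by rewrite absz_gt0.
- by rewrite -polyC_nat abszE.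
- by left; exists q; rewrite ?polyC_nat.
- by right.
Qed.
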